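(* Let $(X,d)$ be a compact metric space, $f:X\to X$ a continuous map, and $u:X\to\mathbb{R}$ a positive continuous function. If $K\subset X$ is non-empty and compact, then $$\dim_{\rm BSC}K=\sup\{\underline P_\mu(f):\mu\in M(X),\ \mu(K)=1\}.$$
   Context: $M(X)$ is the set of Borel probability measures on $X$. Bowen balls: for $n\in\mathbb{N}=\{1,2,\dots\}$, $d_n(x,y)=\max\{d(f^kx,f^ky):0\le k\le n-1\}$ and $B_n(x,\varepsilon)=\{y: d_n(x,y)<\varepsilon\}$. A ball $B=B_n(x,\varepsilon)$ is regarded as carrying its length $n(B)=n$ and its center $x$. Put $u(B)=\sup_{y\in B}\sum_{i=0}^{n(B)-1}u(f^iy)$. BS-C dimension: for $Z\subset X$, let $\mathcal W_n(\varepsilon)=\{B_n(x,\varepsilon):x\in Z\}$. For $\alpha>0$, $N\in\mathbb{N}$, $\varepsilon>0$ let $M(Z,\alpha,\varepsilon,N)=\inf_{\mathcal G}\sum_{B\in\mathcal G}\exp(-\alpha u(B))$, the infimum over all finite or countable $\mathcal G\subset\bigcup_{j\ge N}\mathcal W_j(\varepsilon)$ that cover $Z$. Let $m(Z,\alpha,\varepsilon)=\lim_{N\to\infty}M(Z,\alpha,\varepsilon,N)$, $\dim_{\rm BSC}(Z,\varepsilon)=\inf\{\alpha:m(Z,\alpha,\varepsilon)=0\}=\sup\{\alpha:m(Z,\alpha,\varepsilon)=\infty\}$, and $\dim_{\rm BSC}Z=\lim_{\varepsilon\to0}\dim_{\rm BSC}(Z,\varepsilon)$. Measure-theoretical lower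 BS-dimension: for $\mu\in M(X)$, $$\underline P_\mu(f)=\int\underline P_\mu(f,x)\,d\mu(x),\qquad \underline P_\mu(f,x)=\lim_{\varepsilon\to0}\liminf_{n\to\infty}-\frac{\log\mu(B_n(x,\varepsilon))}{\sum_{i=0}^{n-1}u(f^ix)}.$$ *)

(* Defs.v *)
From HB Require Import structures.
From mathcomp Require Import all_boot all_order all_algebra.
From mathcomp Require Import all_classical all_reals all_analysis.

Set Implicit Arguments.
Unset Strict Implicit.
Unset Printing Implicit Defensive.

Import Order.TTheory GRing.Theory Num.Theory.
Import numFieldNormedType.Exports.

Local Open Scope classical_set_scope.
Local Open Scope ring_scope.

(* Every measurableType is pointed, so the Borel structure needs a point. *)
#[short(type="pmetricType")]
HB.structure Definition PointedMetric (R : numDomainType) :=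
  {T of Metric R T & Pointed T}.

Notation borel X := (g_sigma_algebraType (@open X)).

Section BowenBalls.
Context {R : realType} {X : pmetricType R}.
Variables (f : X -> X) (u : X -> R).

(* Distances are nonnegative, so the unit 0 does not affect the maximum
   when 0 < n. *)
Definition bowen_dist (n : nat) (x y : X) : R :=
  \big[Num.max/0]_(k < n) mdist (iter k f x) (iter k f y).

Definition bowen_ball (n : nat) (x : X) (eps : R) : set X :=
  [set y | bowen_dist n x y < eps].

Definition birkhoff_sum (n : nat) (x : X) : R := \sum_(i < n) u (iter i f x).

(* A Bowen ball of radius eps is encoded by the pair b = (center, length). *)
Definition ball_weight (eps : R) (b : X * nat) : \bar R :=
  ereal_sup [set (birkhoff_sum b.2 y)%:E | y in bowen_ball b.2 b.1 eps].

(* Countable (possibly finite) families of balls centered in Z, of length at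
   least N, that cover Z. Lengths are meant to be positive; length 0 is only
   possible for N = 0, a value that the limit in N below does not see. *)
Definition bsc_cover (Z : set X) (eps : R) (N : nat) (G : set (X * nat)) :=
  [/\ countable G,
      G `<=` [set b | Z b.1 /\ (N <= b.2)%N] &
      Z `<=` \bigcup_(b in G) bowen_ball b.2 b.1 eps].

Local Open Scope ereal_scope.

Definition bsc_premeasure (Z : set X) (alpha eps : R) (N : nat) : \bar R :=
  ereal_inf [set \esum_(b in G) expeR (- (alpha%:E * ball_weight eps b))
            | G in bsc_cover Z eps N].

Definition bsc_measure (Z : set X) (alpha eps : R) : \bar R :=
  limn (bsc_premeasure Z alpha eps).

Definition bsc_dim_at (Z : set X) (eps : R) : \bar R :=
  ereal_inf [set alpha%:E
            | alpha in [set a : R | (0 < a)%R /\ bsc_measure Z a eps = 0]].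

Definition bsc_dim (Z : set X) : \bar R :=
  lim (bsc_dim_at Z eps @[eps --> (0 : R)^'+]).

(* [lne 0 = -oo], so the quotient is [+oo] at null balls. *)
Definition lower_local_dim (mu : probability (borel X) R) (x : X) : \bar R :=
  lim (limn_einf (fun n =>
         - (lne (mu (bowen_ball n x eps)) / (birkhoff_sum n x)%:E))
       @[eps --> (0 : R)^'+]).

Definition lower_bs_dim (mu : probability (borel X) R) : \bar R :=
  \int[mu]_x lower_local_dim mu x.

End BowenBalls.

(* Main.v *)
Require Import Defs.
From HB Require Import structures.
From mathcomp Require Import all_boot all_order all_algebra.
From mathcomp Require Import all_classical all_reals all_analysis.
From mathcomp Require Import finmap measurable_realfun lra ring.

Import Order.TTheory GRing.Theory Num.Theory.
Import numFieldNormedType.Exports.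

Set Implicit Arguments.
Unset Strict Implicit.
Unset Printing Implicit Defensive.

Local Open Scope classical_set_scope.
Local Open Scope ring_scope.

(** One inequality is a mass distribution principle. If [mu K = 1] and the
    integral of the local dimensions exceeds [s], then the local dimensions
    exceed some value above [s] on a set of positive measure, and part of it
    consists of points whose balls [B_n(x, e)] have measure at most
    [exp (- s S_n u(x))] for a fixed [e] and all large [n], where [S_n u] denotes
    the Birkhoff sum. By uniform continuity of [u], [S_n u] oscillates on a small
    ball [B] by at most a factor close to 1, so for every exponent below [s] a
    cover of [K] by long balls of small radius costs in total at least the measure
    of the closure of that part ([bsc_dim_ge_local], [lower_bs_dim_le]).

    The other inequality is a Frostman lemma ([exists_frostman_measure]), proved
    by duality. Replace covers by finite weighted families of balls whose
    weighted indicators sum to at least one on [K]. The least cost of a family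
    dominating a function is sublinear, and a Hahn-Banach functional below it
    ([hahn_banach]) defines a finitely additive probability [nu], carried by
    [K], whose value on a ball is at most a constant times the cost of the ball
    ([exists_dominated_charge]). Regularizing [nu] by closed sets from inside and
    by open sets from outside yields an outer measure for which open sets are
    Caratheodory measurable, hence a Borel probability [mu] with [mu U <= nu U]
    for [U] open ([exists_regularization]); Bowen balls are open, so the bound
    passes to [mu], and the local dimensions of [mu] on [K] are bounded below.

    The constant is finite because weighted covers are not essentially cheaper
    than covers ([premeasure_le_weighted]): if the weighted mass at each point of
    [K] is at least one, then some length [n] contributes at least
    [(1 - q) q ^ n], and a greedy choice of centers ([greedy_selection]) extracts
    a cover by balls of double radius, at the price of an arbitrarily small
    increase of the exponent. *)

(** * Sublinear functionals and the Hahn-Banach theorem *)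

(** Subadditive real functionals on an abelian group that are homogeneous for
    natural multiples. On a real vector space every sublinear functional is of
    this kind; multiples by natural numbers suffice for the extension theorem
    below. *)
Definition sublinear (R : realType) (V : zmodType) (p : V -> R) :=
  (forall x y, p (x + y) <= p x + p y) /\
  (forall n x, p (x *+ n) = p x *+ n).

Section hahn_banach.
Context {R : realType} {V : zmodType}.
Implicit Types p q : V -> R.

Lemma sublinear0 p : sublinear p -> p 0 = 0.
Proof. by move=> [_ ph]; have := ph 0%N 0; rewrite !mulr0n. Qed.

Lemma sublinear_geN p x : sublinear p -> - p (- x) <= p x.
Proof.
move=> sp; have := sublinear0 sp; have := sp.1 x (- x).
by rewrite subrr => /[swap] ->; lra.
Qed.

Lemma subadditive_sublinear p :
  (forall x y, p (x + y) <= p x + p y) ->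
  (forall n x, p x *+ n <= p (x *+ n)) -> sublinear p.
Proof.
move=> pD pn; split=> // n x; apply/eqP; rewrite eq_le pn andbT.
have p0 : p 0 <= 0 by have := pn 2%N 0; rewrite mul0rn mulr2n; lra.
elim: n => [|n ih]; first by rewrite !mulr0n.
by rewrite !mulrS (le_trans (pD _ _))// lerD2l.
Qed.

(** The largest sublinear functional below [p] that takes the value [- p y] at
    [- y]. *)
Definition flatten p y : V -> R :=
  fun x => inf (range (fun t : nat => p (x + y *+ t) - p y *+ t)).

Lemma has_inf_flatten p y x : sublinear p ->
  has_inf (range (fun t : nat => p (x + y *+ t) - p y *+ t)).
Proof.
move=> sp; split; first by exists (p (x + y *+ 0) - p y *+ 0); exists 0%N.
exists (- p (- x)) => _ [t _ <-].
have := sp.1 (x + y *+ t) (- x).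
by rewrite addrAC subrr add0r sp.2; lra.
Qed.

Lemma flatten_le p y x t : sublinear p ->
  flatten p y x <= p (x + y *+ t) - p y *+ t.
Proof.
move=> sp; apply: ge_inf; first exact: (has_inf_flatten _ _ sp).2.
by exists t.
Qed.

Lemma flatten_ge p y x b : sublinear p ->
  (forall t, b <= p (x + y *+ t) - p y *+ t) -> b <= flatten p y x.
Proof.
move=> sp H; apply: lb_le_inf; first exact: (has_inf_flatten _ _ sp).1.
by move=> _ [t _ <-]; exact: H.
Qed.

Lemma sublinear_flatten p y : sublinear p -> sublinear (flatten p y).
Proof.
move=> sp; apply: subadditive_sublinear.
- move=> x1 x2; rewrite -lerBlDr; apply: (flatten_ge sp) => s.
  rewrite lerBlDr -lerBlDl; apply: (flatten_ge sp) => t.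
  rewrite lerBlDl.
  apply: (le_trans (flatten_le y (x1 + x2) (s + t) sp)).
  have := sp.1 (x1 + y *+ s) (x2 + y *+ t).
  by rewrite addrACA -mulrnDr [p y *+ _]mulrnDr; lra.
- move=> [|n] x; apply: (flatten_ge sp) => t.
    by rewrite !mulr0n add0r sp.2 subrr.
  have := lerMn2r n.+1 (flatten p y x) (p (x + y *+ t) - p y *+ t).
  rewrite (flatten_le y x t sp) orbT => /idP/le_trans; apply.
  rewrite mulrnBl -!sp.2 mulrnDl -!mulrnA.
  have -> : y *+ (t * n.+1) = y *+ t + y *+ (t * n) by rewrite -mulrnDr mulnS.
  have := sp.1 (x *+ n.+1 + y *+ t) (y *+ (t * n)).
  by rewrite -mulrnDr -addrA -mulrnDr -mulnS !sp.2 mulnS mulrnDr; lra.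
Qed.

Lemma flatten_le_id p y x : sublinear p -> flatten p y x <= p x.
Proof.
by move=> sp; have := flatten_le y x 0 sp; rewrite !mulr0n addr0 subr0.
Qed.

Lemma flattenN p y : sublinear p -> flatten p y (- y) <= - p y.
Proof.
move=> sp; have := flatten_le y (- y) 1 sp.
by rewrite !mulr1n addNr (sublinear0 sp) sub0r.
Qed.

(** Zorn's lemma; the lower bound of a chain is its pointwise infimum. *)
Lemma exists_minimal_sublinear p : sublinear p ->
  exists q, [/\ sublinear q, forall x, q x <= p x &
    forall r, sublinear r -> (forall x, r x <= q x) -> r = q].
Proof.
move=> sp.
pose T := {q : V -> R | sublinear q /\ forall x, q x <= p x}.
pose leT (q r : T) := `[< forall x, sval r x <= sval q x >].
have qlb (q : T) x : - p (- x) <= sval q x.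
  have [sq qp] := svalP q.
  by have := sublinear_geN x sq; have := qp (- x); lra.
have [| | |A totA|[q [sq qp]] qmin] := @Zorn T leT.
- by move=> q; apply/asboolP.
- move=> q r s /asboolP qr /asboolP rs; apply/asboolP => x.
  exact: le_trans (rs x) (qr x).
- move=> [q hq] [r hr] /asboolP/= qr /asboolP/= rq.
  by apply: eq_exist; apply/funext => x; apply/eqP; rewrite eq_le qr rq.
- have [->|/set0P[q0 Aq0]] := eqVneq A set0.
    by exists (exist _ p (conj sp (fun x => lexx _))).
  pose m x := inf [set sval q x | q in A].
  have hm x : has_inf [set sval q x | q in A].
    split; first by exists (sval q0 x); exists q0.
    by exists (- p (- x)) => _ [q _ <-]; exact: qlb.
  have mle (q : T) x : A q -> m x <= sval q x.
    by move=> Aq; apply: ge_inf; [exact: (hm x).2|exists q].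
  have mge x b : (forall q : T, A q -> b <= sval q x) -> b <= m x.
    move=> H; apply: lb_le_inf; first exact: (hm x).1.
    by move=> _ [q Aq <-]; exact: H.
  have sm : sublinear m.
    apply: subadditive_sublinear.
    - move=> x y; rewrite -lerBlDr; apply: (mge) => q Aq.
      rewrite lerBlDr -lerBlDl; apply: (mge) => r Ar; rewrite lerBlDl.
      have [/asboolP qr|/asboolP rq] := totA _ _ Aq Ar.
        apply: (le_trans (mle r _ Ar)); apply: (le_trans ((svalP r).1.1 x y)).
        by rewrite lerD2r.
      apply: (le_trans (mle q _ Aq)); apply: (le_trans ((svalP q).1.1 x y)).
      by rewrite lerD2l.
    - move=> n x; apply: (mge) => q Aq; rewrite (svalP q).1.2.
      by rewrite lerMn2r mle// orbT.
  have mp x : m x <= p x.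
    by apply: (le_trans (mle q0 x Aq0)); exact: (svalP q0).2.
  exists (exist _ m (conj sm mp)) => q Aq; apply/asboolP => x /=; exact: mle.
- exists q; split=> // r sr rq.
  have rp x : r x <= p x := le_trans (rq x) (qp x).
  have /qmin/(congr1 sval)//= :
      leT (exist _ q (conj sq qp)) (exist _ r (conj sr rp)).
  by apply/asboolP.
Qed.

(** A minimal sublinear functional [q] is additive, since it coincides with
    [flatten q z] for all [z]. Choosing [q] below [flatten p y] rather than below
    [p] forces equality at [y]. *)
Theorem hahn_banach p y : sublinear p -> exists L : V -> R,
  [/\ forall x z, L (x + z) = L x + L z, forall x, L x <= p x & L y = p y].
Proof.
move=> sp; have spy := sublinear_flatten y sp.
have [q [sq qpy qmin]] := exists_minimal_sublinear spy.
have qD x z : q (x + z) = q x + q z.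
  apply/eqP; rewrite eq_le sq.1/=.
  have zE := qmin _ (sublinear_flatten z sq) (fun x => flatten_le_id z x sq).
  have := flatten_le z x 1 sq; rewrite zE !mulr1n; lra.
exists q; split=> //.
- by move=> x; apply: (le_trans (qpy x)); exact: flatten_le_id.
- apply/eqP; rewrite eq_le (le_trans (qpy y)) ?flatten_le_id//=.
  have := qD y (- y); rewrite subrr (sublinear0 sq).
  have := qpy (- y); have := flattenN y sp; lra.
Qed.

End hahn_banach.

(** * Finitely additive probabilities dominated on a family of sets *)

Section dominated_charge.
Context {R : realType} {T : pointedType} {I : choiceType}.
Variables (B : I -> set T) (w : I -> R) (D : set I) (K : set T).
Implicit Type s : seq (R * I).

(** A weighted family is a list of pairs (coefficient, index), with
    nonnegative coefficients and indices in [D]. *)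
Definition weighted_family s := all (fun b => (0 <= b.1) && (b.2 \in D)) s.

Definition family_cost s : R := \sum_(b <- s) b.1 * w b.2.

Definition family_mass s (x : T) : R := \sum_(b <- s) b.1 * \1_(B b.2) x.

(** The cheapest weighted family whose mass is at least [g] on [K]. *)
Definition covering_cost (g : T -> R) : R :=
  inf [set family_cost s | s in
        [set s | weighted_family s /\ forall x, K x -> g x <= family_mass s x]].

Let scale (a : R) s := [seq (a * b.1, b.2) | b <- s].

Let cost_scale a s : family_cost (scale a s) = a * family_cost s.
Proof.
rewrite /family_cost big_map mulr_sumr; apply: eq_bigr => b _.
by rewrite mulrA.
Qed.

Let mass_scale a s x : family_mass (scale a s) x = a * family_mass s x.
Proof.
rewrite /family_mass big_map mulr_sumr; apply: eq_bigr => b _.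
by rewrite mulrA.
Qed.

Let weighted_scale a s :
  0 <= a -> weighted_family s -> weighted_family (scale a s).
Proof.
move=> a0 /allP/= sD; apply/allP => _ /mapP[b /sD/andP[b0 bD] ->] /=.
by rewrite bD mulr_ge0.
Qed.

Hypothesis w_ge0 : forall i, D i -> 0 <= w i.

Lemma family_cost_ge0 s : weighted_family s -> 0 <= family_cost s.
Proof.
move=> /allP/= sD; rewrite /family_cost big_seq; apply: sumr_ge0 => b.
by move=> /sD/andP[b0 /set_mem bD]; rewrite mulr_ge0// w_ge0.
Qed.

Lemma covering_cost_le g s : weighted_family s ->
  (forall x, K x -> g x <= family_mass s x) -> covering_cost g <= family_cost s.
Proof.
move=> sD gs; apply: ge_inf; last by exists s.
by exists 0 => _ [r [/family_cost_ge0 ? _] <-].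
Qed.

Variable s0 : seq (R * I).
Hypothesis s0D : weighted_family s0.
Hypothesis s0K : forall x, K x -> 1 <= family_mass s0 x.

Lemma covering_cost_ge (g : {fimfun T >-> R}) b :
  (forall s, weighted_family s -> (forall x, K x -> g x <= family_mass s x) ->
     b <= family_cost s) ->
  b <= covering_cost g.
Proof.
move=> H; apply: lb_le_inf; last by move=> _ [s [? ?] <-]; exact: H.
have /finite_seqP[r gr] : finite_set (range g) by [].
pose M := \sum_(y <- r) `|y|.
have M0 : 0 <= M by apply: sumr_ge0.
have gM x : g x <= M.
  have : g x \in r by have : range g (g x) by [exists x]; rewrite gr.
  move=> gxr; rewrite /M (big_rem _ gxr)/=.
  by rewrite (le_trans (ler_norm _))// lerDl sumr_ge0.
exists (family_cost (scale M s0)), (scale M s0) => //; split.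
  exact: weighted_scale.
move=> x Kx; rewrite mass_scale (le_trans (gM x))//.
by rewrite -[leLHS]mulr1 ler_wpM2l// s0K.
Qed.

Let sublinear_covering_cost :
  sublinear (covering_cost : {fimfun T >-> R} -> R).
Proof.
apply: subadditive_sublinear.
- move=> g h; rewrite -lerBlDr; apply: covering_cost_ge => s sD gs.
  rewrite lerBlDr -lerBlDl; apply: covering_cost_ge => r rD hr.
  rewrite lerBlDl (_ : family_cost s + _ = family_cost (s ++ r)); last first.
    by rewrite /family_cost big_cat.
  apply: covering_cost_le; first by rewrite /weighted_family all_cat; apply/andP.
  move=> x Kx; rewrite /family_mass big_cat/=.
  by rewrite lerD ?gs ?hr.
- move=> [|n] g.
    by rewrite mulr0n; apply: covering_cost_ge => s /family_cost_ge0.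
  apply: covering_cost_ge => s sD gs.
  rewrite -mulr_natl mulrC -ler_pdivlMr// mulrC -cost_scale.
  apply: covering_cost_le; first exact: weighted_scale.
  move=> x Kx; rewrite mass_scale mulrC ler_pdivlMr//.
  apply: le_trans (gs x Kx).
  have -> : (g *+ n.+1) x = g x *+ n.+1.
    elim: n {gs} => [|n IH]; first by rewrite !mulr1n.
    by rewrite mulrS [RHS]mulrS -IH.
  by rewrite mulr_natr.
Qed.

(** Duality: if covering [K] with total mass at least one costs at least [c],
    then some finitely additive probability charges only [K] and gives each
    [B i] at most the share [w i / c]. *)
Lemma exists_dominated_charge c : 0 < c ->
  (forall s, weighted_family s -> (forall x, K x -> 1 <= family_mass s x) ->
     c <= family_cost s) ->
  exists nu : set T -> R, [/\ forall A, 0 <= nu A,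
    forall A A', A `&` A' = set0 -> nu (A `|` A') = nu A + nu A',
    nu setT = 1, nu (~` K) = 0 & forall i, D i -> nu (B i) <= w i / c].
Proof.
move=> c0 cP.
have [L [LD Lp L1]] := hahn_banach (cst_fimfun 1) sublinear_covering_cost.
set m := covering_cost _ in L1.
have cm : c <= m by apply: covering_cost_ge => s sD s1; exact: cP.
have m0 : 0 < m := lt_le_trans c0 cm.
have L0 : L 0 = 0 by have := LD 0 0; rewrite addr0; lra.
have LN g : L (- g) = - L g.
  by have := LD g (- g); rewrite subrr L0; lra.
have cost0 (g : {fimfun T >-> R}) : (forall x, K x -> g x <= 0) -> L g <= 0.
  move=> g0; apply: (le_trans (Lp g)).
  have -> : (0 : R) = family_cost [::] by rewrite /family_cost big_nil.
  apply: covering_cost_le => // x Kx.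
  by rewrite /family_mass big_nil g0.
pose nu A := L (indic_fimfun A) / m.
have nu0 A : 0 <= nu A.
  rewrite divr_ge0 ?(ltW m0)// -oppr_le0 -LN; apply: cost0 => x _ /=.
  by rewrite oppr_le0 indicE.
exists nu; split=> //.
- move=> A A' AA'; rewrite /nu -mulrDl -LD; congr (L _ / _).
  apply/fimfuneqP => x /=; rewrite -[RHS]/(\1_A x + \1_A' x) !indicE in_setU.
  have [/set_mem Ax|] := boolP (x \in A); last by rewrite add0r.
  rewrite memNset ?addr0// => A'x.
  by have : (A `&` A') x by []; rewrite AA'.
- rewrite /nu (_ : indic_fimfun setT = cst_fimfun 1) ?L1 ?divff ?gt_eqF//.
  by apply/fimfuneqP => x /=; rewrite indicT.
- apply/eqP; rewrite eq_le nu0 andbT pmulr_lle0 ?invr_gt0//.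
  apply: cost0 => x Kx /=; rewrite indicE memNset//; exact.
- move=> i Di; rewrite /nu ler_pdivrMr// mulrAC ler_pdivlMr//.
  have LB : L (indic_fimfun (B i)) <= w i.
    apply: (le_trans (Lp _)).
    have -> : w i = family_cost [:: (1, i)].
      by rewrite /family_cost big_seq1 mul1r.
    apply: covering_cost_le; first by rewrite /weighted_family/= ler01 mem_set.
    by move=> x _; rewrite /family_mass big_seq1 mul1r.
  apply: (@le_trans _ _ (w i * c)); first by rewrite ler_pM2r.
  by rewrite ler_wpM2l// w_ge0.
Qed.

End dominated_charge.

(** * Regularization of a finitely additive probability *)

Lemma measurable_closed_borel (T : ptopologicalType) (C : set T) :
  closed C -> measurable (C : set (borel T)).
Proof.
move=> cC; rewrite -[C]setCK; apply: measurableC.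
by apply: sub_sigma_algebra; rewrite openC.
Qed.

Section regularization.
Local Open Scope ereal_scope.
Context {R : realType} {T : ptopologicalType}.
Hypothesis cptT : compact [set: T].
Hypothesis regT : regular_space T.
Variable nu : set T -> R.
Hypothesis nu_ge0 : forall A, (0 <= nu A)%R.
Hypothesis nuU : forall A B, A `&` B = set0 -> nu (A `|` B) = (nu A + nu B)%R.
Hypothesis nuT : nu setT = 1%R.

(** The inner regularization of [nu] by closed sets, meant for open sets. *)
Definition inner_closed (U : set T) : \bar R :=
  ereal_sup [set (nu C)%:E | C in [set C | closed C /\ C `<=` U]].

(** The outer regularization by open sets of the previous set function; on
    open sets both agree. *)
Definition outer_open (A : set T) : \bar R :=
  ereal_inf [set inner_closed U | U in [set U | open U /\ A `<=` U]].

Let nu0 : nu set0 = 0%R.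
Proof. by have := nuU (setI0 set0); rewrite setU0; lra. Qed.

Let nu_mono A B : A `<=` B -> (nu A <= nu B)%R.
Proof.
move=> AB; rewrite -(setDUK AB) nuU; first by rewrite lerDl.
by rewrite setDE setIC -setIA setICl setI0.
Qed.

Let nuU_le A B : (nu (A `|` B) <= nu A + nu B)%R.
Proof.
have -> : A `|` B = A `|` (B `\` A).
  by apply/seteqP; split=> x /=; have [] := pselect (A x); tauto.
rewrite nuU; first by rewrite lerD2l nu_mono// => x [].
by apply/seteqP; split=> x //= -[? []].
Qed.

Let nu_bigU_le (F : (set T)^nat) n :
  (nu (\big[setU/set0]_(i < n) F i) <= \sum_(i < n) nu (F i))%R.
Proof.
elim: n => [|n ih]; first by rewrite !big_ord0 nu0.
by rewrite !big_ord_recr/= (le_trans (nuU_le _ _))// lerD2r.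
Qed.

Let inner_ge U C : closed C -> C `<=` U -> (nu C)%:E <= inner_closed U.
Proof. by move=> ? ?; apply: ereal_sup_ubound; exists C. Qed.

Let inner_le U : inner_closed U <= (nu U)%:E.
Proof.
by apply: ge_ereal_sup => _ [C [_ CU] <-]; rewrite lee_fin nu_mono.
Qed.

Let inner_mono U V : U `<=` V -> inner_closed U <= inner_closed V.
Proof.
move=> UV; apply: ereal_sup_le => _ [C [? CU] <-].
by exists C => //; split=> // x /CU/UV.
Qed.

Let inner_ge0 U : 0 <= inner_closed U.
Proof.
by rewrite (le_trans _ (inner_ge (@closed0 _) (@sub0set _ U)))// lee_fin.
Qed.

Let outer_le U A : open U -> A `<=` U -> outer_open A <= inner_closed U.
Proof. by move=> ? ?; apply: ereal_inf_lbound; exists U. Qed.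

Lemma outer_open_inner U : open U -> outer_open U = inner_closed U.
Proof.
move=> oU; apply/eqP; rewrite eq_le outer_le//=.
by apply: le_ereal_inf_tmp => _ [V [_ UV] <-]; exact: inner_mono.
Qed.

Let outer_ge0 A : 0 <= outer_open A.
Proof. by apply: le_ereal_inf_tmp => _ [U _ <-]. Qed.

Let outer_mono : {homo outer_open : A B / A `<=` B >-> A <= B}.
Proof.
move=> A B AB; apply: ereal_inf_le_tmp => _ [U [oU BU] <-].
by exists U => //; split=> // x /AB/BU.
Qed.

Let outer0 : outer_open set0 = 0.
Proof.
apply/eqP; rewrite eq_le outer_ge0 andbT (outer_open_inner open0).
by rewrite (le_trans (inner_le _))// nu0.
Qed.

(** By compactness a closed subset of a union of open sets is covered by
    finitely many closed sets, each contained in one of them. *)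
Lemma inner_closed_bigcup (U : (set T)^nat) : (forall n, open (U n)) ->
  inner_closed (\bigcup_n U n) <= \sum_(n <oo) inner_closed (U n).
Proof.
move=> oU; apply: ge_ereal_sup => _ [C [cC CU] <-].
have cptC : compact C by apply: subclosed_compact cptT _.
have /choice[V VP] x : exists V : nat * set T, C x ->
    [/\ open V.2, V.2 x & closure V.2 `<=` U V.1].
  have [Cx|nCx] := pselect (C x); last by exists (0%N, set0).
  have [n _ Unx] := CU _ Cx.
  have [W Wx WU] := regT (open_nbhs_nbhs (conj (oU n) Unx)).
  exists (n, interior W) => _ /=; split.
  - exact: open_interior.
  - exact: Wx.
  - by apply: subset_trans WU; apply: closureS; exact: interior_subset.
move: cptC; rewrite compact_cover => cov.
have [x /VP[]//|x Cx|D DC CD] := cov T C (fun x => (V x).2).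
  by exists x => //; have [] := VP _ Cx.
pose F n := \bigcup_(x in [set x | x \in D /\ (V x).1 = n]) closure (V x).2.
have cF n : closed (F n).
  apply: closed_bigcup => [|x _]; last exact: closed_closure.
  by apply: (sub_finite_set _ (finite_fset D)) => x [].
have FU n : F n `<=` U n.
  by move=> y [x [xD <-]]; have [_ _] := VP x (set_mem (DC _ xD)); apply.
pose N := (\max_(x <- D) (V x).1).+1.
have CF : C `<=` \big[setU/set0]_(n < N) F n.
  move=> y /CD[x /= xD Vxy].
  rewrite -(bigcup_mkord N F); exists (V x).1.
    by rewrite /= ltnS; exact: (leq_bigmax_seq x).
  by exists x => //; exact: subset_closure.
apply: (@le_trans _ _ (\sum_(0 <= n < N) inner_closed (U n))); last first.
  exact: nneseries_lim_ge.
rewrite big_mkord (@le_trans _ _ (\sum_(n < N) nu (F n))%:E)//.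
  by rewrite lee_fin (le_trans (nu_mono CF) (nu_bigU_le _ _)).
by rewrite -sumEFin; apply: lee_sum => n _; exact: inner_ge.
Qed.

Lemma outer_open_sigma_subadditive : sigma_subadditive outer_open.
Proof.
move=> F; apply/lee_addgt0Pr => e e0.
have /choice[U UP] n : exists U, [/\ open U, F n `<=` U &
    inner_closed U <= outer_open (F n) + (e / (2 ^ n.+1)%:R)%:E].
  have fin : outer_open (F n) \is a fin_num.
    rewrite ge0_fin_numE//; apply: (@le_lt_trans _ _ 1); last exact: ltry.
    rewrite (le_trans (outer_le openT (@subsetT _ _)))//.
    by rewrite (le_trans (inner_le _))// nuT.
  have [|_ [U [oU FU] <-] Ule] :=
      @lb_ereal_inf_adherent _ _ (e / (2 ^ n.+1)%:R) _ fin.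
    by rewrite divr_gt0// ltr0n expn_gt0.
  by exists U; split=> //; exact: ltW.
apply: (@le_trans _ _ (inner_closed (\bigcup_n U n))).
  apply: outer_le; first by apply: bigcup_open => n _; have [] := UP n.
  by move=> x [n _ Fnx]; exists n => //; have [_ + _] := UP n; apply.
rewrite (le_trans (inner_closed_bigcup _))//; first by move=> n; have [] := UP n.
apply: (le_trans _ (epsilon_trick _ _ (ltW e0))) => //.
by apply: lee_nneseries => // n _; have [] := UP n.
Qed.

(** Open sets are Caratheodory measurable: closed sets [C] inside [W `&` U]
    and [C'] inside [W `\` C] are disjoint subsets of [W]. *)
Lemma caratheodory_open U : open U -> forall A,
  outer_open (A `&` U) + outer_open (A `&` ~` U) <= outer_open A.
Proof.
move=> oU A; apply: le_ereal_inf_tmp => _ [W [oW AW] <-].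
apply: (@le_trans _ _ (inner_closed (W `&` U) + outer_open (W `&` ~` U))).
  apply: leeD; last by apply: outer_mono => x [/AW].
  by apply: outer_le; [exact: openI|move=> x [/AW]].
have Wfin V : inner_closed V \is a fin_num.
  rewrite ge0_fin_numE//; apply: (@le_lt_trans _ _ (nu V)%:E) => //; exact: ltry.
have Ofin V : outer_open V \is a fin_num.
  rewrite ge0_fin_numE//.
  by rewrite (le_lt_trans (outer_le openT (@subsetT _ _)))// ltey_eq Wfin.
rewrite -leeBrDr//; apply: ge_ereal_sup => _ [C [cC CWU] <-].
rewrite leeBrDr// -leeBrDl//.
apply: (@le_trans _ _ (inner_closed (W `&` ~` C))).
  apply: outer_le; first by apply: openI => //; rewrite openC.
  by move=> x [Wx nUx]; split => // /CWU[].
apply: ge_ereal_sup => _ [C' [cC' CW] <-].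
rewrite leeBrDl// -EFinD -nuU; last first.
  by apply/seteqP; split => // x [Cx /CW[]].
apply: inner_ge; first exact: closedU.
by move=> x [/CWU[]|/CW[]].
Qed.

Theorem exists_regularization :
  exists mu : probability (borel T) R, forall U, open U -> mu U <= (nu U)%:E.
Proof.
pose om : {outer_measure set T -> \bar R} := HB.pack outer_open
  (isOuterMeasure.Build R T outer_open outer0 outer_ge0 outer_mono
    outer_open_sigma_subadditive).
have mcar (A : set (borel T)) : measurable A -> om.-caratheodory A.
  apply: smallest_sub.
    split.
    - exact: caratheodory_measurable_set0.
    - by move=> B; rewrite setTD; exact: caratheodory_measurable_setC.
    - by move=> F; exact: caratheodory_measurable_bigcup.
  by move=> U oU; apply: le_caratheodory_measurable; exact: caratheodory_open.
pose m (A : set (borel T)) : \bar R := om A.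
have msa : semi_sigma_additive m.
  move=> F mF tF mU.
  apply: (@caratheodory_measure_sigma_additive _ _ om F) => //.
  - by move=> i; apply: mcar.
  - exact: mcar.
have mT : m setT = 1.
  apply/eqP; rewrite eq_le /m/= (outer_open_inner openT).
  rewrite (le_trans (inner_le _)) ?nuT//=.
  by rewrite -nuT inner_ge//; exact: closedT.
pose H1 := isMeasure.Build _ (borel T) R m outer0 outer_ge0 msa.
pose m1 : {measure set (borel T) -> \bar R} := HB.pack m H1.
pose H2 := Measure_isProbability.Build _ (borel T) R m1 mT.
pose mu : probability (borel T) R := HB.pack (Measure.sort m1) H2.
exists mu => U oU; rewrite -[mu U]/(outer_open U) outer_open_inner//.
Qed.

End regularization.

(** * Bowen balls and Birkhoff sums *)

Section bowen.
Context {R : realType} {X : pmetricType R}.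
Variables (f : X -> X) (u : X -> R).
Implicit Types (x y z : X) (n : nat) (e : R) (b : X * nat).

Lemma bowen_ballP n x e y : 0 < e ->
  bowen_ball f n x e y <->
  forall k, (k < n)%N -> mdist (iter k f x) (iter k f y) < e.
Proof.
move=> e0; split=> [/bigmax_ltP[_ H] k kn|H].
  exact: (H (Ordinal kn) isT).
by apply/bigmax_ltP; split=> // k _; exact: H.
Qed.

Lemma bowen_ball_center n x e : 0 < e -> bowen_ball f n x e x.
Proof. by move=> e0; apply/bowen_ballP => // k _; rewrite mdistxx. Qed.

Lemma bowen_ball_sym n x e y : 0 < e ->
  bowen_ball f n x e y -> bowen_ball f n y e x.
Proof.
move=> e0 /(bowen_ballP _ _ _ e0) xy; apply/bowen_ballP => // k kn.
by rewrite metric_sym xy.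
Qed.

Lemma bowen_ball_triangle n x y z e e' : 0 < e -> 0 < e' ->
  bowen_ball f n x e y -> bowen_ball f n y e' z -> bowen_ball f n x (e + e') z.
Proof.
move=> e0 e'0 /(bowen_ballP _ _ _ e0) xy /(bowen_ballP _ _ _ e'0) yz.
apply/bowen_ballP => [|k kn]; first by rewrite addr_gt0.
by rewrite (le_lt_trans (metric_triangle _ (iter k f y) _))// ltrD ?xy ?yz.
Qed.

(** Two points of a ball are at Bowen distance less than twice its radius. *)
Lemma bowen_ball_double n x y z e : 0 < e ->
  bowen_ball f n z e x -> bowen_ball f n z e y -> bowen_ball f n x (2 * e) y.
Proof.
move=> e0 zx zy; rewrite mulr_natl mulr2n.
exact: (bowen_ball_triangle e0 e0 (bowen_ball_sym e0 zx) zy).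
Qed.

Lemma le_bowen_ball n x e e' : e <= e' ->
  bowen_ball f n x e `<=` bowen_ball f n x e'.
Proof. by move=> ee' y /lt_le_trans; apply. Qed.

Lemma open_mdist_ball x e : open [set y | mdist x y < e].
Proof.
rewrite openE => y /= xy; apply/nbhs_ballP; exists (e - mdist x y) => /=.
  by rewrite subr_gt0.
move=> z; rewrite ballEmdist/= ltrBrDl => /(le_lt_trans _); apply.
exact: metric_triangle.
Qed.

Lemma open_bowen_ball n x e : continuous f -> 0 < e ->
  open (bowen_ball f n x e).
Proof.
move=> cf e0.
have cfk k : continuous (iter k f).
  by elim: k => [|k ih] y /=; [exact: cvg_id|exact: continuous_comp (ih y) (cf _)].
have -> : bowen_ball f n x e =
    \bigcap_(k in `I_n) (iter k f @^-1` [set y | mdist (iter k f x) y < e]).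
  apply/seteqP; split=> y.
    by move/(bowen_ballP _ _ _ e0) => xy k kn; exact: xy.
  by move=> xy; apply/bowen_ballP.
rewrite bigcap_mkord; elim/big_ind : _ => //.
- exact: openT.
- exact: openI.
- move=> i _; apply: open_comp => [y _|]; first exact: cfk.
  exact: open_mdist_ball.
Qed.

Hypothesis cptX : compact [set: X].
Hypothesis cu : continuous u.
Hypothesis u_gt0 : forall x, 0 < u x.

Let nonemptyX : [set: X] !=set0. Proof. by exists point. Qed.

Lemma exists_lower_bound : exists2 m, 0 < m & forall x, m <= u x.
Proof.
have [x _ ux] := compact_EVT_min nonemptyX cptX (continuous_subspaceT cu).
by exists (u x) => // y; apply: ux; rewrite in_setT.
Qed.

Lemma exists_upper_bound : exists M, forall x, u x <= M.
Proof.
have [x _ ux] := compact_EVT_max nonemptyX cptX (continuous_subspaceT cu).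
by exists (u x) => y; apply: ux; rewrite in_setT.
Qed.

Lemma birkhoff_sum_ge m n x :
  (forall x, m <= u x) -> n%:R * m <= birkhoff_sum f u n x.
Proof.
move=> mu; rewrite mulr_natl -[in leLHS](card_ord n) -sumr_const.
by apply: ler_sum.
Qed.

Lemma birkhoff_sum_le M n x :
  (forall x, u x <= M) -> birkhoff_sum f u n x <= n%:R * M.
Proof.
move=> uM; rewrite mulr_natl -[in leRHS](card_ord n) -sumr_const.
by apply: ler_sum.
Qed.

Lemma birkhoff_sum_ge0 n x : 0 <= birkhoff_sum f u n x.
Proof. by apply: sumr_ge0 => i _; exact: ltW. Qed.

Lemma birkhoff_sum_gt0 n x : (0 < n)%N -> 0 < birkhoff_sum f u n x.
Proof.
case: n => // n _; rewrite /birkhoff_sum big_ord_recl ltr_pwDl//.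
by apply: sumr_ge0 => i _; exact: ltW.
Qed.

(** The weight [u(B)] as a real number. *)
Definition ball_wt e b : R := fine (ball_weight f u e b).

Lemma ball_weightE e b : 0 < e -> ball_weight f u e b = (ball_wt e b)%:E.
Proof.
move=> e0; rewrite /ball_wt fineK//.
have [M uM] := exists_upper_bound.
apply/fin_numPlt/andP; split.
  apply: (@lt_le_trans _ _ (birkhoff_sum f u b.2 b.1)%:E); first exact: ltNyr.
  by apply: ereal_sup_ubound; exists b.1 => //; exact: bowen_ball_center.
apply: (@le_lt_trans _ _ (b.2%:R * M)%:E); last exact: ltry.
by apply: ge_ereal_sup => _ [y _ <-]; rewrite lee_fin birkhoff_sum_le.
Qed.

Lemma ball_wt_ge e b y : 0 < e -> bowen_ball f b.2 b.1 e y ->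
  birkhoff_sum f u b.2 y <= ball_wt e b.
Proof.
move=> e0 yb; rewrite -lee_fin -ball_weightE//.
by apply: ereal_sup_ubound; exists y.
Qed.

Lemma ball_wt_le e b c : 0 < e ->
  (forall y, bowen_ball f b.2 b.1 e y -> birkhoff_sum f u b.2 y <= c) ->
  ball_wt e b <= c.
Proof.
move=> e0 H; rewrite -lee_fin -ball_weightE//.
by apply: ge_ereal_sup => _ [y yb <-]; rewrite lee_fin H.
Qed.

Lemma le_ball_wt e e' b b' : 0 < e -> 0 < e' -> b.2 = b'.2 ->
  bowen_ball f b.2 b.1 e `<=` bowen_ball f b'.2 b'.1 e' ->
  ball_wt e b <= ball_wt e' b'.
Proof.
move=> e0 e'0 bb' sub; apply: ball_wt_le => // y /sub yb'.
by rewrite bb' ball_wt_ge.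
Qed.

End bowen.

(** * Weighted and unweighted covers *)

Section weighted_covers.
Context {R : realType} {X : pmetricType R}.
Variables (f : X -> X) (u : X -> R) (K : set X).
Hypothesis cptX : compact [set: X].
Hypothesis cu : continuous u.
Hypothesis u_gt0 : forall x, 0 < u x.

Let bball (e : R) (b : X * nat) : set X := bowen_ball f b.2 b.1 e.

(** The pairs (center, length) allowed in covers of [K]. *)
Definition ball_indices (N : nat) : set (X * nat) :=
  [set b | K b.1 /\ (N <= b.2)%N].

(** The cost of a ball in the definition of the dimension. *)
Definition ball_cost (alpha e : R) (b : X * nat) : R :=
  expR (- (alpha * ball_wt f u e b)).

Lemma expeR_ball_weight alpha e b : 0 < e ->
  expeR (- (alpha%:E * ball_weight f u e b))%E = (ball_cost alpha e b)%:E.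
Proof. by move=> e0; rewrite (ball_weightE _ cptX cu)// -EFinM. Qed.

Section greedy.
Variables (N : nat) (e alpha : R) (a : nat -> R).
Hypothesis e0 : 0 < e.
Hypothesis alpha0 : 0 <= alpha.
Hypothesis a_gt0 : forall n, 0 < a n.

Let mass_at (s : seq (R * (X * nat))) n x : R :=
  \sum_(b <- s | b.2.2 == n) b.1 * \1_(bball e b.2) x.

(** Greedy selection. Balls of radius [e] and length [n] that contain a chosen
    center [x] contain no point outside the ball of radius [2 * e] around [x],
    so removing them does not change the mass at the remaining points. *)
Lemma greedy_selection (s : seq (R * (X * nat))) (Z : set X) :
  weighted_family (ball_indices N) s -> Z `<=` K ->
  (forall x, Z x -> exists n, a n <= mass_at s n x) ->
  exists E : seq (X * nat), [/\ [set` E] `<=` ball_indices N,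
    Z `<=` \bigcup_(b in [set` E]) bball (2 * e) b &
    \sum_(b <- E) a b.2 * ball_cost alpha (2 * e) b <=
      family_cost (ball_cost alpha e) s].
Proof.
have e20 : 0 < 2 * e by rewrite mulr_gt0.
have [k] := ubnP (size s); elim: k s Z => // k ih s Z sk sD ZK Zmass.
have [Z0|/set0P[x Zx]] := eqVneq Z set0.
  exists [::]; split; [by []|by rewrite Z0|rewrite big_nil].
  by apply: family_cost_ge0 sD => b _; exact: expR_ge0.
have [n an] := Zmass _ Zx.
pose near_x (b : R * (X * nat)) := (b.2.2 == n) && (x \in bball e b.2).
pose s1 := [seq b <- s | near_x b]; pose s2 := [seq b <- s | ~~ near_x b].
have mass1 : mass_at s n x = \sum_(b <- s1) b.1.
  rewrite /mass_at big_filter big_mkcond [RHS]big_mkcond; apply: eq_bigr => b _.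
  rewrite /near_x indicE; case: eqP => //= _.
  by case: ifP; rewrite ?mulr1 ?mulr0.
have s1D : weighted_family (ball_indices N) s1.
  by apply/allP => b; rewrite mem_filter => /andP[_ /(allP sD)].
have s2D : weighted_family (ball_indices N) s2.
  by apply/allP => b; rewrite mem_filter => /andP[_ /(allP sD)].
have s1_gt0 : (0 < size s1)%N.
  rewrite lt0n size_eq0; apply/eqP => s10.
  by move: an; rewrite mass1 s10 big_nil leNgt a_gt0.
have Nn : (N <= n)%N.
  case: s1 {mass1} s1D s1_gt0 (filter_all near_x s : all near_x s1) => //= b s1'.
  by move=> /andP[/andP[_ /set_mem[_ Nb]] _] _ /andP[/andP[/eqP <-]].
have s2k : (size s2 < k)%N.
  move: sk; rewrite ltnS; apply: leq_trans.
  have := count_predC near_x s; rewrite !size_filter => <-.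
  by rewrite -[X in (X < _)%N]add0n ltn_add2r -size_filter.
have [|y [Zy yx]|E [ED EZ Ecost]] := ih s2 (Z `\` bball (2 * e) (x, n)) s2k s2D.
- by move=> y [/ZK].
- have [n' an'] := Zmass _ Zy; exists n'; apply: le_trans an' _.
  rewrite /mass_at big_filter_cond [leLHS]big_mkcond [leRHS]big_mkcond.
  apply: ler_sum => b _; rewrite [X in _ <= if X then _ else _]andbC.
  case: ifP => //= bn'.
  case: ifPn => //; rewrite negbK => /andP[/eqP bn /set_mem xb].
  rewrite indicE memNset ?mulr0// => yb; apply: yx.
  rewrite /bball/= -bn; exact: bowen_ball_double xb yb.
exists ((x, n) :: E); split.
- move=> b /=; rewrite inE => /orP[/eqP ->|/ED//].
  by split=> //; exact: ZK.
- move=> y Zy; have [yx|nyx] := pselect (bball (2 * e) (x, n) y).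
    by exists (x, n) => //=; rewrite inE eqxx.
  have [b /= bE yb] := EZ y (conj Zy nyx).
  by exists b => //=; rewrite inE bE orbT.
- rewrite big_cons /=.
  have -> : family_cost (ball_cost alpha e) s =
      family_cost (ball_cost alpha e) s1 + family_cost (ball_cost alpha e) s2.
    by rewrite /family_cost !big_filter [LHS](bigID near_x).
  rewrite lerD//.
  apply: (@le_trans _ _ (mass_at s n x * ball_cost alpha (2 * e) (x, n))).
    by rewrite ler_wpM2r// expR_ge0.
  rewrite mass1 mulr_suml /family_cost big_seq [leRHS]big_seq.
  apply: ler_sum => b bs1.
  have := allP s1D _ bs1 => /andP[b0 _].
  rewrite ler_wpM2l// ler_expR lerN2 ler_wpM2l//.
  move: bs1; rewrite mem_filter => /andP[/andP[/eqP bn /set_mem xb] _].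
  apply: (le_ball_wt cptX cu) => //= y yb; rewrite -bn.
  exact: bowen_ball_double xb yb.
Qed.

End greedy.

Lemma sum_length (s : seq (R * (X * nat))) (F : R * (X * nat) -> R) :
  exists L, \sum_(b <- s) F b = \sum_(n < L) \sum_(b <- s | b.2.2 == n) F b.
Proof.
exists (\max_(b <- s) b.2.2).+1.
rewrite [RHS](exchange_big_dep xpredT)//= big_seq [RHS]big_seq.
apply: eq_bigr => b bs.
have bL : (b.2.2 < (\max_(b <- s) b.2.2).+1)%N.
  by rewrite ltnS; exact: (leq_bigmax_seq b).
rewrite (eq_bigl (pred1 (Ordinal bL))) ?big_pred1_eq//.
Qed.

Lemma esum_seq_le (E : seq (X * nat)) (F : X * nat -> R) :
  (forall b, 0 <= F b) ->
  (\esum_(b in [set` E]) (F b)%:E <= (\sum_(b <- E) F b)%:E)%E.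
Proof.
move=> F0.
rewrite esum_fset; [|exact: finite_seq|by move=> b _; rewrite lee_fin].
have -> : [set` E] = [set` undup E].
  by apply/seteqP; split=> b /=; rewrite mem_undup.
rewrite -fsbig_seq ?undup_uniq// sumEFin lee_fin.
elim: E => //= b E ih; rewrite [leRHS]big_cons.
case: ifP => _; first by rewrite (le_trans ih)// lerDr.
by rewrite big_cons lerD2l.
Qed.

(** Any weighted family of mass at least one on [K] costs at least a fixed
    multiple of the premeasure of [K] for a larger exponent and the double
    radius. The masses [a n := (1 - q) q ^ n] have sum one, so at each point
    some length [n] carries mass at least [a n]; the factor [q ^ n] is absorbed
    by the gap [delta] between the exponents, because [u(B)] grows at least
    linearly with the length. *)
Lemma premeasure_le_weighted alpha delta e : 0 <= alpha -> 0 < delta -> 0 < e ->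
  exists2 k : R, 0 < k & forall N s, weighted_family (ball_indices N) s ->
    (forall x, K x -> 1 <= family_mass (bball e) s x) ->
    (bsc_premeasure f u K (alpha + delta) (2 * e) N <=
      (k * family_cost (ball_cost alpha e) s)%:E)%E.
Proof.
move=> alpha0 delta0 e0.
have e20 : 0 < 2 * e by rewrite mulr_gt0.
have [m m0 mu] := exists_lower_bound cptX cu u_gt0.
pose q := expR (- (delta * m)).
have q0 : 0 < q by exact: expR_gt0.
have q1 : 0 < 1 - q by rewrite subr_gt0 expR_lt1 oppr_lt0 mulr_gt0.
exists (1 - q)^-1; first by rewrite invr_gt0.
move=> N s sD smass.
pose a n := (1 - q) * q ^+ n.
have a0 n : 0 < a n by rewrite mulr_gt0// exprn_gt0.
have [x Kx|E [ED EK Ecost]] := greedy_selection e0 alpha0 a0 sD (@subset_refl _ K).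
  apply: contrapT => /forallNP nH.
  have := smass x Kx; rewrite /family_mass.
  have [L ->] := sum_length s (fun b => b.1 * \1_(bball e b.2) x).
  apply/negP; rewrite -ltNge.
  apply: (@le_lt_trans _ _ (\sum_(n < L) a n)).
    by apply: ler_sum => n _; rewrite leNgt; apply/negP => /ltW /nH.
  rewrite -mulr_sumr -opprB mulNr -subrX1 opprB.
  by rewrite ltrBlDr ltrDl exprn_gt0.
apply: (@le_trans _ _ (\esum_(b in [set` E])
    expeR (- ((alpha + delta)%:E * ball_weight f u (2 * e) b)))%E).
  apply: ereal_inf_lbound; exists [set` E] => //; split.
  - exact/finite_set_countable.
  - exact: ED.
  - exact: EK.
under eq_esum do rewrite expeR_ball_weight//.
apply: le_trans (esum_seq_le _ _) _; first by move=> b; exact: expR_ge0.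
rewrite lee_fin ler_pdivlMl// (le_trans _ Ecost)//.
rewrite mulr_sumr; apply: ler_sum => b _; rewrite /a -mulrA ler_pM2l//.
rewrite -expRM_natl -expRD ler_expR.
have : b.2%:R * m <= ball_wt f u (2 * e) b.
  apply: le_trans (birkhoff_sum_ge f b.2 b.1 mu) _.
  by apply: (ball_wt_ge cptX cu) => //; exact: bowen_ball_center.
by move=> /(ler_wpM2l (ltW delta0)); lra.
Qed.

End weighted_covers.

(** * Limits, lower integrals and local dimensions *)

Section limits.
Context {R : realType}.
Local Open Scope ereal_scope.

Lemma lim_at_right0_sup (F : R -> \bar R) :
  (forall e e' : R, (0 < e)%R -> (e <= e')%R -> F e' <= F e) ->
  lim (F e @[e --> (0 : R)^'+]) =
    ereal_sup [set F e | e in [set e : R | (0 < e)%R]].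
Proof.
move=> Fmono.
have -> : [set e : R | (0 < e)%R] = [set` Interval (BRight 0%R) +oo%O].
  by apply/seteqP; split=> x; rewrite /= in_itv/= andbT.
apply/cvg_lim => //; apply: nonincreasing_at_right_cvge; first by rewrite bnd_simp.
by move=> x y; rewrite !in_itv/= !andbT => x0 y0 xy; exact: Fmono.
Qed.

Lemma limn_einf_sup_einfs (v : (\bar R)^nat) :
  limn_einf v = ereal_sup (range (einfs v)).
Proof. by rewrite limn_einf_lim; apply/cvg_lim => //; exact: cvg_einfs_sup. Qed.

Lemma lt_limn_einf (v : (\bar R)^nat) s : s < limn_einf v ->
  exists N, forall n, (N <= n)%N -> s < v n.
Proof.
rewrite limn_einf_sup_einfs => /ereal_sup_gt[_ [N _ <-] sN].
exists N => n Nn; apply: lt_le_trans sN _.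
by apply: ereal_inf_lbound; exists n.
Qed.

Lemma limn_einf_ge (v : (\bar R)^nat) s N :
  (forall n, (N <= n)%N -> s <= v n) -> s <= limn_einf v.
Proof.
move=> sv; rewrite limn_einf_sup_einfs; apply: le_ereal_sup_tmp.
exists (einfs v N); first by exists N.
by apply: le_ereal_inf_tmp => _ [n /= Nn <-]; exact: sv.
Qed.

Lemma le_limn_einf (v w : (\bar R)^nat) :
  (forall n, v n <= w n) -> limn_einf v <= limn_einf w.
Proof.
move=> vw; rewrite !limn_einf_sup_einfs; apply: ge_ereal_sup => _ [N _ <-].
apply: le_ereal_sup_tmp; exists (einfs w N); first by exists N.
apply: le_ereal_inf_tmp => _ [n /= Nn <-]; apply: le_trans (vw n).
by apply: ereal_inf_lbound; exists n.
Qed.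

End limits.

(** The integral of a nonnegative function is by definition a supremum over
    simple functions below it, so neither of the next two bounds requires the
    integrand to be measurable. *)
Section lower_integral.
Local Open Scope ereal_scope.
Context d (T : measurableType d) (R : realType).
Variables (mu : probability T R) (g : T -> \bar R).
Hypothesis g0 : forall x, 0 <= g x.

Import HBNNSimple.

Lemma lower_integral_ge (A : set T) (s : R) : measurable A -> mu A = 1 ->
  (0 <= s)%R -> (forall x, A x -> s%:E <= g x) -> s%:E <= \int[mu]_x g x.
Proof.
move=> mA muA s0 sg.
have -> : s%:E = \int[mu]_(x in A) (cst s%:E) x.
  by rewrite integral_cst// [X in _ * X]muA mule1.
have h0 x : 0 <= (cst s%:E \_ A) x by apply: erestrict_ge0 => y _; rewrite lee_fin.
rewrite integral_mkcond !ge0_integralTE//.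
apply: ereal_sup_le => _ [h hle <-]; exists h => // x /=.
apply: le_trans (hle x) _; rewrite /patch.
by case: ifPn => // /set_mem; exact: sg.
Qed.

Lemma lower_integral_le (D : \bar R) : 0 <= D ->
  (forall (A : set T) (s : R), measurable A -> 0 < mu A ->
    (0 < s)%R -> (forall x, A x -> s%:E < g x) -> s%:E <= D) ->
  \int[mu]_x g x <= D.
Proof.
case: D => [D D0 H|_ _|//]; last by rewrite leey.
rewrite ge0_integralTE//; apply: ge_ereal_sup => _ [h hg <-].
apply/lee_addgt0Pr => e e0; rewrite -integralT_nnsfun.
have -> : D%:E + e%:E = \int[mu]_x (cst (D + e)%:E) x.
  by rewrite integral_cst// [X in _ * X](probability_setT mu) mule1.
apply: ae_ge0_le_integral => //.
- by move=> x _; rewrite lee_fin; exact: fun_ge0.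
- exact/measurable_EFinP.
- by move=> x _; rewrite lee_fin addr_ge0// ltW.
pose A := h @^-1` `](D + e)%R, +oo[.
have mA : measurable A by exact: measurable_funPTI.
exists A; split => //; last first.
  move=> x /= nx; rewrite /A/= in_itv/= andbT ltNge; apply/negP => hx.
  by apply: nx => _; rewrite lee_fin.
apply/eqP; rewrite eq_le measure_ge0 andbT leNgt; apply/negP => A0.
have De0 : (0 < D + e)%R by rewrite ltr_wpDl.
have := H A (D + e)%R mA A0 De0.
suff AH x : A x -> (D + e)%:E < g x.
  by move=> /(_ AH); rewrite lee_fin; lra.
rewrite /A/= in_itv/= andbT => hx; apply: lt_le_trans (hg x).
by rewrite lte_fin.
Qed.

End lower_integral.

(** * Monotonicity of the dimension and local dimensions in the radius *)

Section dimensions.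
Local Open Scope ereal_scope.
Context {R : realType} {X : pmetricType R}.
Variables (f : X -> X) (u : X -> R) (K : set X).
Hypothesis cptX : compact [set: X].
Hypothesis cf : continuous f.
Hypothesis cu : continuous u.
Hypothesis u_gt0 : forall x, (0 < u x)%R.

Lemma bsc_premeasure_ge0 alpha e N : 0 <= bsc_premeasure f u K alpha e N.
Proof.
apply: le_ereal_inf_tmp => _ [G _ <-]; apply: esum_ge0 => b _.
exact: expeR_ge0.
Qed.

Lemma le_bsc_premeasure_radius alpha e e' N : (0 <= alpha)%R -> (0 < e)%R ->
  (e <= e')%R -> bsc_premeasure f u K alpha e' N <= bsc_premeasure f u K alpha e N.
Proof.
move=> a0 e0 ee'; have e'0 := lt_le_trans e0 ee'.
apply: le_ereal_inf_tmp => _ [G [cG GD GK] <-].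
apply: ge_ereal_inf; exists (\esum_(b in G)
    expeR (- (alpha%:E * ball_weight f u e' b))); last first.
  apply: le_esum => b _; rewrite !(expeR_ball_weight _ cptX cu)// lee_fin.
  rewrite ler_expR lerN2 ler_wpM2l//; apply: (le_ball_wt cptX cu) => //.
  exact: le_bowen_ball.
exists G => //; split=> // x /GK[b Gb xb]; exists b => //.
exact: le_bowen_ball xb.
Qed.

Lemma bsc_measureE alpha e :
  bsc_measure f u K alpha e = ereal_sup (range (bsc_premeasure f u K alpha e)).
Proof.
apply/cvg_lim => //; apply: ereal_nondecreasing_cvgn => N N' NN'.
apply: ereal_inf_le_tmp => _ [G [cG GD GK] <-]; exists G => //; split=> // b /GD.
by move=> [? N'b]; split=> //; exact: leq_trans N'b.
Qed.

Lemma bsc_measure_eq0 alpha e : bsc_measure f u K alpha e = 0 <->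
  forall N, bsc_premeasure f u K alpha e N = 0.
Proof.
rewrite bsc_measureE; split=> [m0 N|p0]; apply/eqP; rewrite eq_le.
  rewrite bsc_premeasure_ge0 andbT -m0.
  by apply: ereal_sup_ubound; exists N.
apply/andP; split; first by apply: ge_ereal_sup => _ [N _ <-]; rewrite p0.
by rewrite -(p0 0%N); apply: ereal_sup_ubound; exists 0%N.
Qed.

Lemma bsc_dim_at_ge0 e : 0 <= bsc_dim_at f u K e.
Proof. by apply: le_ereal_inf_tmp => _ [a [/ltW a0 _] <-]; rewrite lee_fin. Qed.

Lemma bsc_dimE :
  bsc_dim f u K =
    ereal_sup [set bsc_dim_at f u K e | e in [set e : R | (0 < e)%R]].
Proof.
apply: lim_at_right0_sup => e e' e0 ee'.
apply: ereal_inf_le_tmp => _ [a [a0 /bsc_measure_eq0 ma] <-].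
exists a => //; split=> //; apply/bsc_measure_eq0 => N; apply/eqP.
by rewrite eq_le bsc_premeasure_ge0 -(ma N) le_bsc_premeasure_radius// ltW.
Qed.

Lemma bsc_dim_ge e : (0 < e)%R -> bsc_dim_at f u K e <= bsc_dim f u K.
Proof. by move=> e0; rewrite bsc_dimE; apply: ereal_sup_ubound; exists e. Qed.

Variable mu : probability (borel X) R.

Let local_quotient (x : X) (e : R) (n : nat) : \bar R :=
  - (lne (mu (bowen_ball f n x e)) / (birkhoff_sum f u n x)%:E).

Let mball n x e : (0 < e)%R -> measurable (bowen_ball f n x e : set (borel X)).
Proof. by move=> e0; apply: sub_sigma_algebra; exact: open_bowen_ball. Qed.

Let le_mu_ball n x e e' : (0 < e)%R -> (e <= e')%R ->
  mu (bowen_ball f n x e) <= mu (bowen_ball f n x e').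
Proof.
move=> e0 ee'; have e'0 := lt_le_trans e0 ee'.
by apply: (le_measure mu (mem_set (mball n x e0)) (mem_set (mball n x e'0)));
  exact: le_bowen_ball.
Qed.

Lemma local_quotient_geP x e n (s : R) : (0 < n)%N -> (0 < e)%R ->
  (s%:E <= local_quotient x e n) =
  (mu (bowen_ball f n x e) <= (expR (- (s * birkhoff_sum f u n x)))%:E).
Proof.
move=> n0 e0; have S0 := birkhoff_sum_gt0 f u_gt0 x n0.
rewrite /local_quotient inver gt_eqF//.
have : 0 <= mu (bowen_ball f n x e) by [].
have : mu (bowen_ball f n x e) < +oo.
  by rewrite (le_lt_trans (probability_le1 _ _)) ?ltry//; exact: mball.
case: (mu _) => // r _; rewrite lee_fin le_eqVlt => /predU1P[<-|r0].
  rewrite le0_lneNy// gt0_mulNye ?lte_fin ?invr_gt0//= leey.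
  by rewrite lee_fin expR_ge0.
rewrite lne_EFin// -EFinM -EFinN !lee_fin lerNr ler_pdivrMr// mulNr.
by rewrite -[in RHS](lnK (x := r)) ?posrE// ler_expR.
Qed.

Lemma lower_local_dimE x : lower_local_dim f u mu x =
  ereal_sup [set limn_einf (local_quotient x e) | e in [set e : R | (0 < e)%R]].
Proof.
apply: lim_at_right0_sup => e e' e0 ee'; apply: le_limn_einf => -[|n].
  have ball0 r : (0 < r)%R -> bowen_ball f 0 x r = setT.
    by move=> r0; apply/seteqP; split=> // y _; apply/bowen_ballP.
  by rewrite !ball0//; exact: lt_le_trans ee'.
rewrite leeN2 lee_wpmul2r//.
  by rewrite inve_ge0 lee_fin birkhoff_sum_ge0.
rewrite lee_lne ?in_itv/= ?measure_ge0 ?leey//.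
exact: le_mu_ball.
Qed.

Lemma lower_local_dim_ge0 x : 0 <= lower_local_dim f u mu x.
Proof.
rewrite lower_local_dimE; apply: le_ereal_sup_tmp.
exists (limn_einf (local_quotient x 1)); first by exists 1%R => /=.
apply: (@limn_einf_ge _ _ _ 1) => n n1; rewrite local_quotient_geP//.
by rewrite mul0r oppr0 expR0 probability_le1//; exact: mball.
Qed.

(** A uniform exponential bound on the measures of the balls around [x] bounds
    the local dimension from below. *)
Lemma lower_local_dim_ge x e N (alpha s c : R) : (0 < e)%R -> (0 < c)%R ->
  (s < alpha)%R ->
  (forall n, (N <= n)%N -> mu (bowen_ball f n x e) <=
     (expR (- (alpha * birkhoff_sum f u n x)) / c)%:E) ->
  s%:E <= lower_local_dim f u mu x.
Proof.
move=> e0 c0 sa mub; rewrite lower_local_dimE; apply: le_ereal_sup_tmp.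
exists (limn_einf (local_quotient x e)); first by exists e.
have [m m0 um] := exists_lower_bound cptX cu u_gt0.
pose M := Num.truncn (- ln c / ((alpha - s) * m)).
apply: (@limn_einf_ge _ _ _ (maxn N M.+1)) => n.
rewrite geq_max => /andP[Nn Mn].
rewrite local_quotient_geP//; last exact: leq_ltn_trans Mn.
apply: le_trans (mub n Nn) _.
rewrite lee_fin -[X in (_ / X)%R](lnK (x := c)) ?posrE// -expRN -expRD ler_expR.
have : (- ln c <= (alpha - s) * birkhoff_sum f u n x)%R.
  have as0 : (0 < alpha - s)%R by rewrite subr_gt0.
  apply: (@le_trans _ _ ((alpha - s) * (n%:R * m))%R); last first.
    by rewrite ler_pM2l// birkhoff_sum_ge.
  rewrite [(n%:R * m)%R]mulrC mulrA -ler_pdivrMl ?mulr_gt0// mulrC.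
  by rewrite (le_trans (ltW (truncnS_gt _)))// ler_nat.
lra.
Qed.

End dimensions.

(** * Dimensions of measures are bounded by the dimension of the set *)

Section mass_distribution.
Local Open Scope ereal_scope.
Context {R : realType} {X : pmetricType R}.
Variables (f : X -> X) (u : X -> R) (K : set X).
Hypothesis cptX : compact [set: X].
Hypothesis cf : continuous f.
Hypothesis cu : continuous u.
Hypothesis u_gt0 : forall x, (0 < u x)%R.
Hypothesis cptK : compact K.

Lemma uniformly_continuous_potential (g : R) : (0 < g)%R ->
  exists2 d : R, (0 < d)%R & forall x y, (mdist x y < d)%R -> (u x <= u y + g)%R.
Proof.
move=> g0.
have : \forall d \near (0 : R)^'+, [set: X] `<=`
    (fun x => forall y, (mdist x y < d)%R -> (u x <= u y + g)%R).
  move/compact_near_coveringP : cptX; apply => x _.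
  have g20 : (0 < g / 2)%R by rewrite divr_gt0.
  have /cvgrPdist_lt ux := @cu x.
  have /nbhs_ballP[r /= r0 xr] := ux _ g20.
  exists (ball x (r / 2), [set d | (0 < d < r / 2)%R]).
    split=> /=; first by apply: nbhsx_ballx; rewrite divr_gt0.
    near=> d; apply/andP; split; first by near: d; exact: nbhs_right_gt.
    by near: d; apply: nbhs_right_lt; rewrite divr_gt0.
  move=> [x' d] /= [xx' /andP[d0 dr]] y x'y.
  have xy : ball x r y.
    rewrite [r]splitr; apply: ball_triangle xx' _.
    by rewrite ballEmdist/=; exact: lt_trans dr.
  have x'r : ball x r x'.
    by apply: le_ball xx'; rewrite ler_pdivrMr// ler_peMr ?ltW// ltr1n.
  have := xr _ xy; have := xr _ x'r.
  by rewrite /= !ltr_norml => /andP[? ?] /andP[? ?]; lra.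
move=> H; near (0 : R)^'+ => d; exists d.
  by near: d; exact: nbhs_right_gt.
by move=> x; have : [set: X] x by []; move: x; near: d.
Unshelve. all: by end_near. Qed.

Variable mu : probability (borel X) R.
Hypothesis muK : mu K = 1.

Let mball n x e : (0 < e)%R -> measurable (bowen_ball f n x e : set (borel X)).
Proof. by move=> e0; apply: sub_sigma_algebra; exact: open_bowen_ball. Qed.

Let le_mu (A B : set (borel X)) : measurable A -> measurable B ->
  A `<=` B -> mu A <= mu B.
Proof. by move=> mA mB; exact: (le_measure mu (mem_set mA) (mem_set mB)). Qed.

(** Mass distribution principle: if the cost of every ball centered in [K] is at
    least the measure of its intersection with [C], then the premeasure is at
    least the measure of [C]. Only finitely many balls of a cover matter, since
    [K] is compact. *)
Lemma premeasure_ge_mass (C : set X) (alpha e : R) N : closed C -> (0 < e)%R ->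
  (forall b, ball_indices K N b ->
    mu (C `&` bowen_ball f b.2 b.1 e) <= (ball_cost f u alpha e b)%:E) ->
  mu C <= bsc_premeasure f u K alpha e N.
Proof.
move=> cC e0 Cball; apply: le_ereal_inf_tmp => _ [G [_ GK KG] <-].
have := cptK; rewrite compact_cover => cov.
have [b _|//|D DG KD] := cov _ G (fun b => bowen_ball f b.2 b.1 e).
  exact: open_bowen_ball.
have mC := measurable_closed_borel cC.
have mK := measurable_closed_borel (compact_closed (@metric_hausdorff _ X) cptK).
have -> : mu C = mu (C `&` K).
  have mCK : mu (C `\` K) = 0.
    apply/eqP; rewrite -measure_le0.
    apply: (@le_trans _ _ (mu (~` (K : set (borel X))))).
      apply: le_mu.
      - exact: measurableD.
      - exact: measurableC.
      - by move=> x [].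
    by rewrite probability_setC// [X in _ - X]muK subee.
  rewrite -[in LHS](setDUK (@subIsetl _ C K)) measureU//.
  - by rewrite setDIr setDv set0U [X in _ + X]mCK adde0.
  - exact: measurableI.
  - by apply: measurableD => //; exact: measurableI.
  - by rewrite setDE setIC -setIA setICl setI0.
apply: (@le_trans _ _ (\sum_(b \in [set` D]) mu (C `&` bowen_ball f b.2 b.1 e))).
  apply: content_sub_fsum => //.
  - by move=> b _; apply: measurableI => //; exact: mball.
  - exact: measurableI.
  - by move=> x [Cx /KD[b Db xb]]; exists b.
apply: esum_ge; exists [set` D].
  by split=> // b /= /DG/set_mem.
apply: lee_fsum => // b /= /DG/set_mem/GK Gb.
by rewrite (expeR_ball_weight _ cptX cu)//; exact: Cball.
Qed.

(** A set of positive measure on which the local dimensions exceed [s] forces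
    the dimension of [K] to be at least [s]. *)
Lemma bsc_dim_ge_local (A : set X) (s : R) : measurable (A : set (borel X)) ->
  0 < mu A -> (0 < s)%R ->
  (forall x, A x -> s%:E < lower_local_dim f u mu x) -> s%:E <= bsc_dim f u K.
Proof.
move=> mA A0 s0 As.
(* Each [F k N] is replaced by its closure, which is measurable; an open ball
   meeting the closure still meets [F k N] itself. *)
pose F k N : set X := [set x | forall n, (N <= n)%N -> (0 < n)%N ->
  mu (bowen_ball f n x k.+1%:R^-1) <= (expR (- (s * birkhoff_sum f u n x)))%:E].
have [[k N] /= F0] : exists kN : nat * nat, 0 < mu (closure (F kN.1 kN.2)).
  apply: contrapT => /forallNP F0.
  have nA : mu.-negligible A.
    apply: (@negligibleS _ (borel X) R mu (\bigcup_k \bigcup_N closure (F k N)) A).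
      move=> x /As; rewrite lower_local_dimE// => /ereal_sup_gt[_ [e /= e0 <-]].
      move=> /lt_limn_einf[N sN].
      pose k := Num.truncn e^-1; exists k => //; exists N => //.
      apply: subset_closure => n Nn n0.
      have ke : (k.+1%:R^-1 <= e)%R.
        by rewrite invf_ple ?posrE// ltW// truncnS_gt.
      have := ltW (sN n Nn); rewrite local_quotient_geP//; apply: le_trans.
      apply: le_mu.
      - by apply: mball; rewrite invr_gt0.
      - exact: mball.
      - exact: le_bowen_ball.
    apply: negligible_bigcup => k; apply: negligible_bigcup => N.
    apply/negligibleP; first by apply: measurable_closed_borel; exact: closed_closure.
    apply/eqP; rewrite eq_le measure_ge0 andbT leNgt.
    by apply/negP; exact: (F0 (k, N)).
  by move: A0; rewrite (negligibleP mu mA).1// ltxx.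
have [m m0 um] := exists_lower_bound cptX cu u_gt0.
apply/lee_addgt0Pr => g g0; rewrite -leeBlDr// -EFinB.
have [s'0|s'0] := leP (s - g)%R 0%R.
  apply: le_trans (bsc_dim_ge f K cptX cu ltr01).
  by apply: le_trans (bsc_dim_at_ge0 _ _ _ _); rewrite lee_fin.
set s' := (s - g)%R in s'0 *.
(* the oscillation of [u] that changes Birkhoff sums at most by the factor
   [s / s'] *)
have [d d0 ud] := uniformly_continuous_potential (mulr_gt0 m0 (divr_gt0 g0 s'0)).
pose e := Num.min d (k.+1%:R^-1)%R.
have e0 : (0 < e)%R by rewrite lt_min d0/= invr_gt0.
have e20 : (0 < e / 2)%R by rewrite divr_gt0.
have dble n z x y : bowen_ball f n z (e / 2) x -> bowen_ball f n z (e / 2) y ->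
    bowen_ball f n x e y.
  by move=> zx zy; have := bowen_ball_double e20 zx zy; rewrite mulrC divfK.
apply: le_trans (bsc_dim_ge f K cptX cu e20).
apply: le_ereal_inf_tmp => _ [a [a0 /bsc_measure_eq0 ma] <-].
rewrite lee_fin leNgt; apply/negP => as'.
move: (F0); apply/negP; rewrite -leNgt -(ma N.+1).
apply: premeasure_ge_mass => //; first exact: closed_closure.
move=> [z n] [/= Kz Nn].
have [[y [Fy zy]]|noF] := pselect (F k N `&` bowen_ball f n z (e / 2) !=set0).
  apply: (@le_trans _ _ (mu (bowen_ball f n y k.+1%:R^-1))).
    apply: le_mu.
    - apply: measurableI; last exact: mball.
      by apply: measurable_closed_borel; exact: closed_closure.
    - by apply: mball; rewrite invr_gt0.
    - move=> x [_ zx]; apply: le_bowen_ball (dble _ _ _ _ zy zx).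
      by rewrite ge_min lexx orbT.
  apply: le_trans (Fy n (ltnW Nn) (leq_ltn_trans (leq0n _) Nn)) _.
  rewrite lee_fin ler_expR lerN2.
  have wt : (ball_wt f u (e / 2) (z, n) <= birkhoff_sum f u n y * (s / s'))%R.
    apply: ball_wt_le => // x zx.
    have yx := dble _ _ _ _ zx zy.
    apply: (@le_trans _ _ (birkhoff_sum f u n y + n%:R * (m * (g / s')))%R).
      rewrite mulr_natl -[X in (_ *+ X)%R]card_ord -sumr_const -big_split/=.
      apply: ler_sum => i _; apply: ud.
      apply: lt_le_trans (_ : e <= d)%R; last by rewrite ge_min lexx.
      by move/bowen_ballP : yx; apply.
    have -> : (s / s' = 1 + g / s')%R by rewrite /s'; field; rewrite gt_eqF.
    rewrite mulrDr mulr1 lerD2l mulrA ler_pM2r ?divr_gt0//.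
    exact: birkhoff_sum_ge.
  have wt0 : (0 <= ball_wt f u (e / 2) (z, n))%R.
    apply: le_trans (birkhoff_sum_ge0 f u_gt0 n z) _.
    by apply: (ball_wt_ge cptX cu (b := (z, n))) => //; exact: bowen_ball_center.
  apply: (@le_trans _ _ (s' * ball_wt f u (e / 2) (z, n))%R).
    by rewrite ler_wpM2r// ltW.
  apply: (@le_trans _ _ (s' * (birkhoff_sum f u n y * (s / s')))%R).
    by rewrite ler_pM2l.
  by rewrite le_eqVlt; apply/orP; left; apply/eqP; field; rewrite gt_eqF.
rewrite [X in mu X](_ : _ = set0) ?measure0 ?lee_fin ?expR_ge0//.
apply/seteqP; split=> // y [clF zy]; apply: noF.
by apply: clF; apply: open_nbhs_nbhs; split=> //; exact: open_bowen_ball.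
Qed.

Lemma lower_bs_dim_le : lower_bs_dim f u mu <= bsc_dim f u K.
Proof.
apply: lower_integral_le.
- by move=> x; exact: lower_local_dim_ge0.
- apply: le_trans (bsc_dim_ge f K cptX cu ltr01); exact: bsc_dim_at_ge0.
- exact: bsc_dim_ge_local.
Qed.

End mass_distribution.

(** * Measures of large dimension *)

Section frostman.
Local Open Scope ereal_scope.
Context {R : realType} {X : pmetricType R}.
Variables (f : X -> X) (u : X -> R) (K : set X).
Hypothesis cptX : compact [set: X].
Hypothesis cf : continuous f.
Hypothesis cu : continuous u.
Hypothesis u_gt0 : forall x, (0 < u x)%R.
Hypothesis cptK : compact K.

(** Some weighted family of balls of radius [e] and length [N] covers [K]. *)
Lemma exists_weighted_cover (e : R) N : (0 < e)%R ->
  exists s : seq (R * (X * nat)), weighted_family (ball_indices K N) s /\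
    forall x, K x ->
      (1 <= family_mass (fun b => bowen_ball f b.2 b.1 e) s x)%R.
Proof.
move=> e0; have := cptK; rewrite compact_cover => cov.
have [x _|x Kx|D DK KD] := cov _ K (fun x => bowen_ball f N x e).
- exact: open_bowen_ball.
- by exists x => //; exact: bowen_ball_center.
exists [seq (1%R, (x, N)) | x <- D]; split.
  apply/allP => _ /mapP[x xD ->] /=; rewrite ler01/=.
  by apply/mem_set; split => //; exact/set_mem/DK.
move=> x /KD[y /= yD xy]; rewrite /family_mass big_map (big_rem y)//=.
rewrite mul1r indicE mem_set// lerDl; apply: sumr_ge0 => z _.
by rewrite mul1r indicE.
Qed.

(** Frostman's lemma for Bowen balls: a positive premeasure yields a
    probability on [K] with exponentially small balls. *)
Lemma exists_frostman_measure (alpha delta e : R) N :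
  (0 <= alpha)%R -> (0 < delta)%R -> (0 < e)%R ->
  0 < bsc_premeasure f u K (alpha + delta) (2 * e) N ->
  exists mu : probability (borel X) R, mu K = 1 /\
    exists2 c : R, (0 < c)%R & forall x n, K x -> (N <= n)%N ->
      mu (bowen_ball f n x e) <=
        (expR (- (alpha * birkhoff_sum f u n x)) / c)%:E.
Proof.
move=> alpha0 delta0 e0 p0.
have [k k0 pk] := premeasure_le_weighted f K cptX cu u_gt0 alpha0 delta0 e0.
have [c0 c00 c0p] : exists2 c0 : R, (0 < c0)%R &
    c0%:E <= bsc_premeasure f u K (alpha + delta) (2 * e) N.
  case: (bsc_premeasure _ _ _ _ _ _) p0 => [r r0|_|//]; first by exists r.
  by exists 1%R; rewrite ?leey.
have [s0 [s0D s0K]] := exists_weighted_cover N e0.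
have [||nu [nu0 nuU nuT nuK nuB]] := exists_dominated_charge
    (w := ball_cost f u alpha e) _ s0D s0K (c := (c0 / k)%R) (divr_gt0 c00 k0).
- by move=> b _; exact: expR_ge0.
- move=> s sD sK; rewrite ler_pdivrMr// mulrC -lee_fin.
  exact: le_trans c0p (pk _ _ sD sK).
have [mu munu] := exists_regularization cptX (@uniform_regular X) nu0 nuU nuT.
have clK : closed K by apply: compact_closed cptK; exact: metric_hausdorff.
have mK := measurable_closed_borel clK.
exists mu; split.
  have muCK : mu (~` (K : set (borel X))) = 0.
    apply/eqP; rewrite -measure_le0.
    have -> : 0 = (nu (~` K))%:E by rewrite nuK.
    by apply: munu; rewrite openC.
  rewrite -[K]setCK probability_setC; last exact: measurableC.
  by rewrite [X in _ - X]muCK sube0.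
exists (c0 / k)%R; first by rewrite divr_gt0.
move=> x n Kx Nn; apply: (le_trans (munu _ (open_bowen_ball n x cf e0))).
rewrite lee_fin (le_trans (nuB (x, n) _))//.
rewrite ler_pM2r ?invr_gt0 ?divr_gt0// ler_expR lerN2 ler_wpM2l//.
by apply: (ball_wt_ge cptX cu (b := (x, n))) => //; exact: bowen_ball_center.
Qed.

Lemma exists_EFin_between (x : R) (y : \bar R) : x%:E < y ->
  exists2 t : R, (x < t)%R & t%:E < y.
Proof.
case: y => [y|_|//].
  by rewrite lte_fin => xy; exists ((x + y) / 2)%R; rewrite ?lte_fin; lra.
by exists (x + 1)%R; rewrite ?ltry ?ltrDl.
Qed.

Lemma exists_lower_bs_dim_ge (t : R) : (0 < t)%R -> t%:E < bsc_dim f u K ->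
  exists2 mu : probability (borel X) R, mu K = 1 & t%:E <= lower_bs_dim f u mu.
Proof.
move=> t0; rewrite bsc_dimE// => /ereal_sup_gt[_ [e /= e0 <-]].
move=> /exists_EFin_between[t' tt' t'e].
have [N pN] : exists N, 0 < bsc_premeasure f u K t' e N.
  apply: contrapT => /forallNP p0; move: t'e; apply/negP; rewrite -leNgt.
  apply: ereal_inf_lbound; exists t' => //; split; first exact: lt_trans tt'.
  apply/bsc_measure_eq0 => N; apply/eqP.
  by rewrite eq_le bsc_premeasure_ge0 andbT leNgt; exact/negP/p0.
have [||||mu [muK [c c0 mub]]] := @exists_frostman_measure
    ((t + t') / 2) ((t' - t) / 2) (e / 2) N.
- lra.
- lra.
- lra.
- have -> : ((t + t') / 2 + (t' - t) / 2 = t')%R by lra.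
  by have -> : (2 * (e / 2) = e)%R by lra.
exists mu => //.
have clK : closed K by apply: compact_closed cptK; exact: metric_hausdorff.
have mK := measurable_closed_borel clK.
apply: (lower_integral_ge _ mK muK (ltW t0)).
  by move=> x; exact: lower_local_dim_ge0.
move=> x Kx.
have : (t < (t + t') / 2)%R by lra.
have e20 : (0 < e / 2)%R by rewrite divr_gt0.
move=> /(lower_local_dim_ge cptX cf cu u_gt0 (mu := mu) (x := x) (N := N) e20 c0).
by apply => n Nn; exact: mub.
Qed.

End frostman.

Theorem theorem7p2 (R : realType) (X : pmetricType R) (f : X -> X) (u : X -> R)
    (K : set X) :
  compact [set: X] -> continuous f -> continuous u -> (forall x, 0 < u x) ->
  K !=set0 -> compact K ->
  bsc_dim f u K =
  ereal_sup [set lower_bs_dim f u mu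
            | mu in [set mu : probability (borel X) R | mu K = 1%E]].
Proof.
move=> cptX cf cu u_gt0 [x0 Kx0] cptK.
apply/eqP; rewrite eq_le; apply/andP; split; last first.
  apply: ge_ereal_sup => _ [mu /= muK <-]; exact: lower_bs_dim_le.
set S := ereal_sup _.
(* Dirac masses at points of [K] are admissible; this settles dimension 0. *)
have S0 : (0 <= S)%E.
  pose mu : probability (borel X) R := dirac (x0 : borel X).
  apply: (@le_trans _ _ (lower_bs_dim f u mu)).
    by apply: integral_ge0 => x _; exact: lower_local_dim_ge0.
  by apply: ereal_sup_ubound; exists mu => //=; rewrite diracE mem_set.
rewrite leNgt; apply/negP.
have : S = +oo%E \/ exists2 r : R, 0 <= r & S = r%:E.
  case: S S0 => [r r0|_|//]; [right|by left].
  by exists r.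
move=> [->|[r r0 Sr]]; first by rewrite ltNge leey.
rewrite Sr => /exists_EFin_between[t rt tdim].
have t0 := le_lt_trans r0 rt.
have [mu muK tmu] := exists_lower_bs_dim_ge cptX cf cu u_gt0 cptK t0 tdim.
have : (t%:E <= S)%E.
  by apply: le_trans tmu _; apply: ereal_sup_ubound; exists mu.
by rewrite Sr lee_fin leNgt rt.
Qed.
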